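(* Let $p$ be a prime, let $s$ be a positive integer, and let $p^{2s}=ef+1$ for some positive integers $e,f$ with $e\geq 3$. (i) $-1\equiv p^x \pmod e$ for some positive integer $x$ if and only if $-1\equiv p^t \pmod e$ for some positive divisor $t$ of $s$, i.e. if and only if $e\mid p^t+1$ for some $t\mid s$. (ii) Let $t\mid s$. If $e\mid p^t+1$, then $e\mid \frac{p^{2s}-1}{p^d-1}$ for any positive divisor $d$ of $t$. *)

(* Defs.v *)
From mathcomp Require Import all_boot all_order all_algebra.

Set Implicit Arguments.
Unset Strict Implicit.
Unset Printing Implicit Defensive.

(* So the truncated nat operations in (p ^ m - 1) %/ (p ^ d - 1)
   lose nothing when p > 1, d > 0 and d %| m. *)
Lemma dvdn_expn_sub1 (p d m : nat) : d %| m -> p ^ d - 1 %| p ^ m - 1.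
Proof.
move=> /dvdnP[k ->]; rewrite mulnC expnM.
by rewrite !subn1 (predn_exp (p ^ d) k) dvdn_mulr.
Qed.

(* Main.v *)
Require Import Defs.
From mathcomp Require Import all_boot all_order all_algebra.

Set Implicit Arguments.
Unset Strict Implicit.
Unset Printing Implicit Defensive.

(** Part (i): given [p ^ x = -1] and [p ^ (2 * s) = 1] modulo [e], the divisor
    [g = gcdn x s] of [s] works. The exponents [k] with [p ^ k = 1] are closed
    under gcd, so [p ^ (2 * g) = 1]; hence [p ^ (g * k)] depends only on the
    parity of [k]. As [-1] and [1] differ modulo [e >= 3], the quotient [x / g]
    is odd, and therefore [p ^ g = p ^ x = -1].

    Part (ii): [p ^ d - 1] divides [p ^ t - 1], so [e * (p ^ d - 1)] divides
    [(p ^ t + 1) * (p ^ t - 1) = p ^ (2 * t) - 1], which in turn divides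
    [p ^ (2 * s) - 1]. *)

Lemma eqz_modN1_dvdn (e n : nat) : (-1 = n%:Z %[mod e%:Z])%Z <-> e %| n + 1.
Proof.
rewrite -[e %| _]/((e%:Z %| (n + 1)%N%:Z)%Z) PoszD -[Posz 1]GRing.opprK -eqz_mod_dvd.
by split => [-> | /eqP ->].
Qed.

Lemma expn_modn1_mull (e p a k : nat) :
  p ^ a = 1 %[mod e] -> p ^ (k * a) = 1 %[mod e].
Proof. by move=> pa1; rewrite mulnC expnM -modnXm pa1 modnXm exp1n. Qed.

(** Bezout gives [gcdn a b + c * b] as a multiple of [a]; the summand [c * b]
    contributes a factor [1], so no power of [p] has to be cancelled. *)
Lemma expn_modn1_gcdn (e p a b : nat) : 0 < a ->
  p ^ a = 1 %[mod e] -> p ^ b = 1 %[mod e] -> p ^ gcdn a b = 1 %[mod e].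
Proof.
move=> a_gt0 pa1 pb1; have [c _ /dvdnP[q gcd_eq]] := Bezoutl b a_gt0.
rewrite -(expn_modn1_mull q pa1) -gcd_eq expnD -modnMmr.
by rewrite (expn_modn1_mull c pb1) modnMmr muln1.
Qed.

Lemma dvdn_add1_sqr_modn1 (e q : nat) : e %| q + 1 -> q ^ 2 = 1 %[mod e].
Proof.
case: q => [|q]; first by rewrite dvdn1 => /eqP ->; rewrite !modn1.
move=> e_dvd; apply/eqP; rewrite eqn_mod_dvd ?expn_gt0 //.
by rewrite -[X in _ - X](exp1n 2) subn_sqr dvdn_mull.
Qed.

Lemma dvdn_add1_gcdn (e p x s : nat) : 2 < e -> 0 < s ->
  p ^ (2 * s) = 1 %[mod e] -> e %| p ^ x + 1 -> e %| p ^ gcdn x s + 1.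
Proof.
move=> e_gt2 s_gt0 ps1 e_dvd_x; set g := gcdn x s.
have pg1 : p ^ (2 * g) = 1 %[mod e].
  rewrite /g gcdnC muln_gcdr; apply: expn_modn1_gcdn => //; first by rewrite muln_gt0.
  by rewrite mulnC expnM; apply: dvdn_add1_sqr_modn1.
have /dvdnP[k xE] : g %| x := dvdn_gcdl x s.
have p_even : p ^ (k./2 * (2 * g)) = 1 %[mod e] by apply: expn_modn1_mull.
have {}xE : x = odd k * g + k./2 * (2 * g).
  by rewrite xE -{1}(odd_double_half k) mulnDl -muln2 mulnA.
move: e_dvd_x; rewrite xE expnD /dvdn -modnDml -modnMmr p_even modnMmr muln1.
case: (odd k); first by rewrite mul1n modnDml.
(* For even [k] this says that [e] divides [2]. *)
by rewrite mul0n expn0 modnDml modn_small.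
Qed.

Lemma dvdn_expn_quotient (e p s t d : nat) : 1 < p -> 0 < d -> d %| t ->
  t %| s -> e %| p ^ t + 1 -> e %| (p ^ (2 * s) - 1) %/ (p ^ d - 1).
Proof.
move=> p_gt1 d_gt0 d_t t_s e_dvd.
have d_2s : d %| 2 * s by rewrite dvdn_mull // (dvdn_trans d_t).
rewrite dvdn_divRL; last exact: dvdn_expn_sub1.
apply: (@dvdn_trans (p ^ (2 * t) - 1)).
  rewrite mulnC [2 * t]mulnC expnM -[X in _ ^ 2 - X](exp1n 2) subn_sqr.
  by apply: dvdn_mul => //; apply: dvdn_expn_sub1.
by apply: dvdn_expn_sub1; rewrite dvdn_pmul2l.
Qed.

Theorem theorem1p4 (p s e f : nat)
    (hp : prime p) (hs : 0 < s) (he0 : 0 < e) (hf : 0 < f) (he : 3 <= e)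
    (hef : p ^ (2 * s) = e * f + 1) :
  (((exists x : nat, 0 < x /\ (-1 = (p ^ x)%N%:Z %[mod e%:Z])%Z)
    <-> (exists t : nat, [/\ 0 < t, t %| s & (-1 = (p ^ t)%N%:Z %[mod e%:Z])%Z]))
   /\
   ((exists x : nat, 0 < x /\ (-1 = (p ^ x)%N%:Z %[mod e%:Z])%Z)
    <-> (exists t : nat, [/\ 0 < t, t %| s & e %| p ^ t + 1])))
  /\
  (forall t : nat, t %| s -> e %| p ^ t + 1 ->
     forall d : nat, 0 < d -> d %| t ->
       e %| (p ^ (2 * s) - 1) %/ (p ^ d - 1)).
Proof.
have ps1 : p ^ (2 * s) = 1 %[mod e] by rewrite hef mulnC modnMDl.
have descend x : 0 < x /\ (-1 = (p ^ x)%N%:Z %[mod e%:Z])%Z ->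
    [/\ 0 < gcdn x s, gcdn x s %| s & e %| p ^ gcdn x s + 1].
  case=> x_gt0 /eqz_modN1_dvdn e_dvd; split; first by rewrite gcdn_gt0 x_gt0.
    exact: dvdn_gcdr.
  exact: dvdn_add1_gcdn.
split; last first.
  by move=> t t_s e_dvd d d_gt0 d_t; apply: (dvdn_expn_quotient (prime_gt1 hp) d_gt0 d_t t_s).
split; split.
- by case=> x /descend[g_gt0 g_s e_dvd]; exists (gcdn x s); split=> //; apply/eqz_modN1_dvdn.
- by case=> t [t_gt0 _ ?]; exists t.
- by case=> x /descend ?; exists (gcdn x s).
- by case=> t [t_gt0 _ e_dvd]; exists t; split=> //; apply/eqz_modN1_dvdn.
Qed.
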